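(* Let $S$ be a Polish space with metric $d$, let $c:S\times S\to[0,\infty]$ be a symmetric cost function satisfying conditions (A)–(D) of the context, with $a:S\to\mathbb{R}_+$ the function in (C), and let $\Gamma_0\subset C_b(S)$ be an admissible set. For $b>0$ let $b\Gamma_0=\{b\cdot f: f\in\Gamma_0\}$. Then for $\mu,\nu\in\mathcal{P}(S)$ with $\mu,\nu\in L^1(a)$, $$\lim_{b\to\infty}G_{b\Gamma_0}(\mu\Vert\nu)=R(\mu\Vert\nu).$$
   Context: $\mathcal{P}(S)$ is the set of Borel probability measures on $S$, $\mathcal{M}(S)$ the finite signed Borel measures, and $C_b(S)$ the bounded continuous functions $S\to\mathbb{R}$, endowed with the weak topology induced by $\mathcal{M}(S)$ (the coarsest topology making $g\mapsto\int_S g\,d\mu$ continuous for every $\mu\in\mathcal{M}(S)$). A set $\Gamma\subset C_b(S)$ is called admissible if: (1) $\Gamma$ is convex and closed (in this weak topology); (2) $g\in\Gamma$ implies $-g\in\Gamma$, and $\Gamma$ contains all constant functions; (3) for all $\mu,\nu\in\mathcal{P}(S)$ with $\mu\ne\nu$ there is $g\in\Gamma$ with $\int_S g\,d\mu\neq\int_S g\,d\nu$. $G_\Gamma(\mu\Vert\nu)=\sup_{g\in\Gamma}\{\int_S g\,d\mu-\log\int_S e^g\,d\nu\}$. $R(\mu\Vert\nu)=\int_S\log\frac{d\mu}{d\nu}\,d\mu$ if $\mu\ll\nu$, and $R(\mu\Vert\nu)=\infty$ otherwise. The value $+\infty$ is allowed on both sides. Conditions on the cost $c$ (symmetric means $c(x,y)=c(y,x)$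 for all $x,y\in S$): (A) There is a nonempty subset $Q\subset C_b(S)$ such that $c(x,y)=\sup_{u\in Q}(u(x)-u(y))$ for all $(x,y)\in S\times S$. (B) The set $\mathrm{Lip}(c,S;C_b(S))=\{f\in C_b(S): f(x)-f(y)\le c(x,y)\text{ for all }x,y\in S\}$ is measure determining: for all $\mu,\nu\in\mathcal{P}(S)$ with $\mu\ne\nu$ there is $f$ in this set with $\int_S f\,d\mu\ne\int_S f\,d\nu$. (C) There exists $a:S\to\mathbb{R}_+$ such that $c(x,y)\le a(x)+a(y)$ for all $x,y\in S$. Write $L^1(a)=\{\theta\in\mathcal{P}(S):\int_S a\,d\theta<\infty\}$. (D) There exist compact sets $K_m\subset S$, $m\in\mathbb{N}$, with $K_m\subset K_{m+1}$ for all $m$ and $S=\bigcup_{m\in\mathbb{N}}K_m$; and for each $m$ there exist $\theta_m:\mathbb{R}_+\to\mathbb{R}_+$ with $\lim_{s\to0}\theta_m(s)=0$ and $\delta_m>0$ such that $c(x,y)\le\theta_m(d(x,y))$ for all $x,y\in K_m$ with $d(x,y)\le\delta_m$. *)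

(* Defs.v *)
From HB Require Import structures.
From mathcomp Require Import all_boot all_order all_algebra.
From mathcomp Require Import all_classical all_reals all_analysis giry.

Set Implicit Arguments.
Unset Strict Implicit.
Unset Printing Implicit Defensive.

Import Order.TTheory GRing.Theory Num.Theory.
Import numFieldNormedType.Exports.

Local Open Scope classical_set_scope.
Local Open Scope ring_scope.

HB.mixin Record isSeparable T & Topological T := {
  separable : exists2 D : set T, countable D & dense D
}.

(* Like every measurableType, a polishType is pointed, hence nonempty; an empty
   space carries no probability measure. *)
#[short(type="polishType")]
HB.structure Definition Polish (R : numDomainType) :=
  {T of Metric R T & Complete T & isSeparable T}.

Definition borel (T : topologicalType) := g_sigma_algebraType (@open T).

Section BoundedContinuous.
Context {R : realType} {S : polishType R}.

Definition Cb : set (S -> R) := [set f | continuous f /\ bounded_fun f].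

(* Any two Hahn decompositions of m differ by an m-null set, so the value does
   not depend on the chosen one. *)
Definition charge_integral (m : {charge set (borel S) -> \bar R})
    (f : S -> R) : R :=
  let: exist P exN := cid (Hahn_decomposition m) in
  let: exist N mPN := cid exN in
  \int[jordan_pos mPN]_x f x - \int[jordan_neg mPN]_x f x.

Definition weak_Cb : topologicalType :=
  sup_topology (fun m : {charge set (borel S) -> \bar R} =>
    Topological.class
      (initial_topology (fun f : set_type Cb => charge_integral m (val f)))).

(* Elements of probability _ _ are functions on all sets, so distinct measures
   have to differ on a measurable set: this is the negation of measure_eq. *)
Definition measure_determining (G : set (S -> R)) :=
  forall mu nu : probability (borel S) R, ~ measure_eq mu nu ->
    exists2 g, G g & \int[mu]_x g x <> \int[nu]_x g x.

Record admissible (G : set (S -> R)) : Prop := Admissible {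
  admissible_sub : G `<=` Cb ;
  admissible_convex : convex_set (G : set (convex_lmodType (S -> R^o))) ;
  admissible_closed : @closed weak_Cb [set f : set_type Cb | G (val f)] ;
  admissible_opp : forall g, G g -> G (\- g) ;
  admissible_cst : forall r, G (cst r) ;
  admissible_determining : measure_determining G
}.

Definition scale_set (b : R) (G : set (S -> R)) : set (S -> R) :=
  [set (fun x => b * f x) | f in G].

Local Open Scope ereal_scope.
Local Open Scope charge_scope.

Definition Gdiv (G : set (S -> R)) (mu nu : probability (borel S) R) : \bar R :=
  ereal_sup [set \int[mu]_x (g x)%:E - lne (\int[nu]_x (expR (g x))%:E)
            | g in G].

Definition relative_entropy (mu nu : probability (borel S) R) : \bar R :=
  if `[< mu `<< nu >] then
    \int[mu]_x lne (('d (charge_of_finite_measure mu) '/d nu) x)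
  else +oo.

Definition L1 (a : S -> R) : set (probability (borel S) R) :=
  [set theta : probability (borel S) R | \int[theta]_x (a x)%:E < +oo].

End BoundedContinuous.

Arguments Cb {R} S.

Section Cost.
Context {R : realType} {S : polishType R}.
Variable c : S -> S -> \bar R.
Local Open Scope ereal_scope.

Definition cost_dual :=
  exists Q : set (S -> R), [/\ Q !=set0, Q `<=` Cb S &
    forall x y, c x y = ereal_sup [set (u x - u y)%:E | u in Q]].

Definition cost_Lip : set (S -> R) :=
  [set f | Cb S f /\ forall x y, (f x - f y)%:E <= c x y].

Definition cost_bounded (a : S -> R) :=
  (forall x, (0 <= a x)%R) /\ forall x y, c x y <= (a x + a y)%:E.

Definition cost_local_modulus :=
  exists K : nat -> set S,
    [/\ forall m, compact (K m),
        forall m, K m `<=` K m.+1,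
        \bigcup_m K m = setT &
        forall m, exists (theta : R -> R) (delta : R),
          [/\ forall s, (0 <= s)%R -> (0 <= theta s)%R,
              theta s @[s --> 0^'+] --> (0 : R)%R,
              (0 < delta)%R &
              forall x y, K m x -> K m y -> (mdist x y <= delta)%R ->
                c x y <= (theta (mdist x y))%:E]].

End Cost.

(* Main.v *)
Require Import Defs.
From HB Require Import structures.
From mathcomp Require Import all_boot all_order all_algebra.
From mathcomp Require Import all_classical all_reals all_analysis.
From mathcomp Require Import measurable_realfun ring lra.

(**
Write Phi(g) = int g dmu - log int e^g dnu. The union V of the sets b Gamma0,
b > 0, is a linear space of bounded measurable functions which contains the
constants and separates probability measures, and the sets b Gamma0 increase
with b because Gamma0 is convex and contains 0. So the limit is the supremum
of Phi over V, and it has to be identified with the relative entropy.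

The relative entropy is the supremum of Phi over all bounded measurable
functions (Gibbs, or Donsker and Varadhan). For the upper bound, integrate
1 + k <= e^k with k = g - log int e^g dnu - log (dmu/dnu)
([gibbs_variational_le]). For the lower bound, take for g truncations of
log (dmu/dnu) ([gibbs_variational_ge]).

The heart of the matter is that V does as well as the space of all bounded
measurable functions ([exponential_bound_extends]). Suppose that Phi <= M on V.
Since log z <= z - 1, the functional int . dmu is dominated on V by the convex
function p(g) = M - 1 + int e^g dnu, which involves no logarithm and is
therefore obviously convex. By Hahn-Banach it extends from V to a linear
functional L <= p on all bounded measurable functions. The domination forces L
to be positive, and it gives t L(1_A) <= |M - 1| + 1 + e^t nu(A) for all t > 0,
so that L(1_A) is small when nu(A) is: choose t large, then nu(A) small.
Hence A |-> L(1_A) is a countably additive probability gamma, and L is the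
integral against gamma ([dominated_functional_representation]). As gamma and
mu agree on V they are equal, so the bound int g dmu <= p(g) holds for all
bounded measurable g, and the lower bound above gives mu << nu and
R(mu || nu) <= M.
*)

Set Implicit Arguments.
Unset Strict Implicit.
Unset Printing Implicit Defensive.

Import Order.TTheory GRing.Theory Num.Theory.
Import numFieldNormedType.Exports.

Local Open Scope classical_set_scope.
Local Open Scope ring_scope.

(** * Extension of a linear functional below a convex function *)

Section HahnBanach.
Context {R : realType} {V : lmodType R}.
Implicit Types (A B F : set V) (f p L : V -> R) (G : set (V * R)).

Definition linear_subspace A :=
  A 0 /\ forall a x y, A x -> A y -> A (a *: x + y).

Definition linear_on A L :=
  forall a x y, A x -> A y -> L (a *: x + y) = a * L x + L y.

Definition convex_on A p := forall t x y, A x -> A y -> 0 <= t <= 1 ->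
  p (t *: x + (1 - t) *: y) <= t * p x + (1 - t) * p y.

(** Partial linear functionals are handled through their graphs, so that
    extension is inclusion. *)
Definition graph_subspace G := G (0, 0) /\
  forall a x y r s, G (x, r) -> G (y, s) -> G (a *: x + y, a * r + s).

Definition hypograph B p : set (V * R) := [set z | B z.1 /\ z.2 <= p z.1].

(** A vertical vector of a subspace spans a whole vertical line, which cannot
    stay below the finite value [p 0]. *)
Lemma graph_subspace_functional B p G x r s :
  graph_subspace G -> G `<=` hypograph B p -> G (x, r) -> G (x, s) -> r = s.
Proof.
move=> [_ GD] Gp Gr Gs; apply: contrapT => /eqP rs.
have rs0 : r - s != 0 by rewrite subr_eq0.
have /= G0 := GD (-1) _ _ _ _ Gs Gr.
have Gt : G (0, `|p 0| + 1).
  have := GD (((`|p 0| + 1) / (r - s)) - 1) _ _ _ _ G0 G0.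
  rewrite scaleN1r addNr scaler0 addr0; congr (G (_, _)).
  by field.
have [_ /=] := Gp _ Gt.
by have := ler_norm (p 0); lra.
Qed.

(** The one-step extension. The slopes (r - p (x - t z)) / t that the new value
    has to exceed lie below the slopes (p (x + t z) - r) / t that it must not
    exceed, by convexity of [p] at a point of the domain; so the supremum of the
    former is a possible value at [z]. *)
Lemma graph_subspace_extend B p G z :
  linear_subspace B -> convex_on B p -> graph_subspace G ->
  G `<=` hypograph B p -> B z ->
  exists s, exists2 G', graph_subspace G' /\ G' `<=` hypograph B p &
    G `<=` G' /\ G' (z, s).
Proof.
move=> [B0 BD] cp [G0 GD] Gp Bz.
have BZ t x : B x -> B (x + t *: z) by move=> Bx; rewrite addrC; exact: BD.
pose E := [set e | exists x r t,
  [/\ G (x, r), 0 < t & e = (r - p (x + (- t) *: z)) / t]].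
have Eub x r t e : G (x, r) -> 0 < t -> E e -> e <= (p (x + t *: z) - r) / t.
  move=> Gx t0 [x' [r' [t' [Gx' t'0 ->]]]].
  have tt'0 : 0 < t + t' by rewrite addr_gt0.
  have [Bx _] := Gp _ Gx; have [Bx' _] := Gp _ Gx'.
  (* these weights cancel the two multiples of z *)
  pose la := t' / (t + t').
  have la01 : 0 <= la <= 1.
    rewrite /la divr_ge0 ?(ltW t'0) ?(ltW tt'0)//=.
    by rewrite ler_pdivrMr// mul1r lerDr ltW.
  have := cp la _ _ (BZ t _ Bx) (BZ (- t') _ Bx') la01.
  have -> : la *: (x + t *: z) + (1 - la) *: (x' + - t' *: z) =
      la *: x + ((1 - la) *: x' + 0).
    rewrite !scalerDr !scalerA addrACA -scalerDl addrA; congr (_ + _).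
    rewrite (_ : _ + _ = 0) ?scale0r// /la; field.
    by rewrite gt_eqF.
  have G1 := GD la _ _ _ _ Gx (GD (1 - la) _ _ _ _ Gx' G0).
  have [_ /= H1 H2] := Gp _ G1.
  have H3 := le_trans H1 H2.
  rewrite ler_pdivrMr// mulrAC ler_pdivlMr//.
  move: H3; rewrite /la.
  have -> : 1 - t' / (t + t') = t / (t + t') by field; rewrite gt_eqF.
  rewrite ![_ / (t + t') * _]mulrAC addr0 -!mulrDl ler_pM2r ?invr_gt0//.
  nra.
have E0 : E !=set0 by exists ((0 - p (0 + (- 1) *: z)) / 1), 0, 0, 1.
have hsE : has_sup E.
  by split=> //; exists ((p (0 + 1 *: z) - 0) / 1) => e Ee; exact: Eub.
exists (sup E); exists [set y | exists x r t,
    [/\ G (x, r), y.1 = x + t *: z & y.2 = r + t * sup E]]; last first.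
  split=> [[x r] Gx|]; first by exists x, r, 0; rewrite scale0r mul0r !addr0.
  by exists 0, 0, 1; rewrite scale1r mul1r !add0r.
split.
  split; first by exists 0, 0, 0; rewrite scale0r mul0r !addr0.
  move=> a _ _ _ _ [x [r [t [Gx /= -> ->]]]] [x' [r' [t' [Gx' /= -> ->]]]].
  exists (a *: x + x'), (a * r + r'), (a * t + t'); split; first exact: GD.
    by rewrite /= scalerDr scalerDl scalerA addrACA.
  by rewrite /=; ring.
move=> [_ _] [x [r [t [Gx /= -> ->]]]].
have [Bx /= rp] := Gp _ Gx; split=> /=; first exact: BZ.
have [t0|t0|->] := ltgtP t 0; last by rewrite scale0r mul0r !addr0.
- have : (r - p (x + (- (- t)) *: z)) / - t <= sup E.
    apply: ub_le_sup; first exact: hsE.2.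
    by exists x, r, (- t); rewrite oppr_gt0.
  by rewrite ler_pdivrMr ?oppr_gt0// opprK; lra.
- have : sup E <= (p (x + t *: z) - r) / t.
    by apply: ge_sup => // e Ee; exact: Eub.
  by rewrite ler_pdivlMr//; lra.
Qed.

(** Zorn's lemma on the graphs that lie below [p] and contain the graph of [f]:
    by [graph_subspace_extend] a maximal one has domain [B]. *)
Theorem hahn_banach B F f p :
  linear_subspace B -> linear_subspace F -> F `<=` B ->
  linear_on F f -> convex_on B p ->
  (forall x, F x -> f x <= p x) ->
  exists L, [/\ linear_on B L, {in F, L =1 f} & forall x, B x -> L x <= p x].
Proof.
move=> sB [F0 FD] FB lf cp fp.
pose good G := [/\ graph_subspace G, G `<=` hypograph B p &
  forall x, F x -> G (x, f x)].
have f0 : f 0 = 0.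
  by have := lf (-1) _ _ F0 F0; rewrite scaler0 addr0; lra.
(* the empty set is added because it is the union of the empty chain *)
have [|A [PA Amax]] := @Zorn_bigcup _ [set G | G = set0 \/ good G].
  move=> C CP Ctot.
  have [[G0 [CG0 gG0]]|nC] := pselect (exists G, C G /\ good G); last first.
    left; rewrite -subset0 => z [G CG Gz].
    have [GE|gG] := CP _ CG; first by move: Gz; rewrite GE.
    by apply: nC; exists G.
  have goodC G z : C G -> G z -> good G.
    by move=> CG Gz; have [GE|//] := CP _ CG; move: Gz; rewrite GE.
  right; split.
  - split; first by exists G0 => //; case: gG0 => -[].
    move=> a x y r s [G1 CG1 G1x] [G2 CG2 G2y].
    have [_ G1D] : graph_subspace G1 by case: (goodC _ _ CG1 G1x).
    have [_ G2D] : graph_subspace G2 by case: (goodC _ _ CG2 G2y).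
    have [G12|G21] := Ctot _ _ CG1 CG2.
    + by exists G2 => //; apply: G2D => //; exact: G12.
    + by exists G1 => //; apply: G1D => //; exact: G21.
  - by move=> z [G CG Gz]; case: (goodC _ _ CG Gz) => _ + _; exact.
  - by move=> x Fx; exists G0 => //; case: gG0 => _ _; exact.
have [sA Ap FA] : good A.
  case: PA => [A0|//]; exfalso.
  apply: (Amax [set z | F z.1 /\ z.2 = f z.1]).
    rewrite A0; split; first exact: sub0set.
    by move=> /(_ (0, 0)) []; split.
  right; split.
  - split=> // a x y r s [/= Fx ->] [/= Fy ->].
    by split; [exact: FD|rewrite /= lf].
  - by move=> [x r] [/= Fx ->]; split; [exact: FB|exact: fp].
  - by move=> x Fx.
have Atot x : B x -> exists r, A (x, r).
  move=> Bx; have [s [G' [sG' G'p] [AG' G'x]]] :=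
    graph_subspace_extend sB cp sA Ap Bx.
  exists s; apply: contrapT => nA; apply: (Amax G').
    by split=> // /(_ _ G'x).
  by right; split=> // y Fy; apply/AG'/FA.
pose L x :=
  if pselect (exists r, A (x, r)) is left e then projT1 (cid e) else 0.
have LA x : B x -> A (x, L x).
  move=> Bx; rewrite /L; case: pselect => [e|/(_ (Atot _ Bx))//].
  exact: projT2 (cid e).
exists L; split.
- move=> a x y Bx By.
  apply: (graph_subspace_functional sA Ap (LA _ (sB.2 a _ _ Bx By))).
  by apply: sA.2; exact: LA.
- move=> x /set_mem Fx.
  exact: (graph_subspace_functional sA Ap (LA _ (FB _ Fx)) (FA _ Fx)).
- by move=> x Bx; have [_] := Ap _ (LA _ Bx).
Qed.

End HahnBanach.

(** * Bounded measurable functions *)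

Section BoundedMeasurable.
Context d (T : measurableType d) (R : realType).

(** The codomain is the regular module, which makes the function space a module
    over the reals, as Hahn-Banach requires. *)
Definition bounded_measurable : set (T -> R^o) :=
  [set f | measurable_fun [set: T] (f : T -> R) /\
           exists K : R, forall x, `|f x| <= K].

Local Notation bm := bounded_measurable.

Lemma subspace_bounded_measurable : linear_subspace bm.
Proof.
split; first by split; [exact: measurable_cst|exists 0 => x; rewrite normr0].
move=> a f g [mf [K fK]] [mg [K' gK']]; split.
  by apply: measurable_funD => //; exact: measurable_funM.
exists (`|a| * K + K') => x; rewrite (le_trans (ler_normD _ _))//.
by apply: lerD => //; rewrite normrM ler_wpM2l.
Qed.

Lemma bounded_measurable_cst r : bm (cst r).
Proof. by split; [exact: measurable_cst|exists `|r|]. Qed.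

Lemma bounded_measurable_indic A : measurable A -> bm \1_A.
Proof.
move=> mA; split; first exact: measurable_indic.
by exists 1 => x; rewrite indicE normr_nat lern1 leq_b1.
Qed.

Lemma bounded_measurable_expR f : bm f -> bm (expR \o f).
Proof.
move=> [mf [K fK]]; split; first exact: measurableT_comp.
exists (expR K) => x /=; rewrite ger0_norm ?expR_ge0// ler_expR.
by rewrite (le_trans (ler_norm _)).
Qed.

Variable m : probability T R.

Lemma total_mass : (m : {measure set T -> \bar R}) setT = 1%E.
Proof. exact: probability_setT. Qed.

Lemma bounded_measurable_integrable f : bm f -> m.-integrable setT (EFin \o f).
Proof.
move=> [mf [K fK]]; apply: measurable_bounded_integrable => //.
  by rewrite total_mass ltry.
exists K; split; first exact: num_real.
by move=> y Ky x _; apply: le_trans (fK x) _; exact: ltW.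
Qed.

Lemma bounded_measurable_fin_num f : bm f ->
  (\int[m]_x (f x)%:E)%E \is a fin_num.
Proof.
by move=> bf; exact: integrable_fin_num (bounded_measurable_integrable bf).
Qed.

Lemma Rintegral_linear : linear_on bm (fun f => \int[m]_x f x).
Proof.
move=> a f g bf bg.
rewrite RintegralD// ?RintegralZl//; try exact: bounded_measurable_integrable.
have [b0 bD] := subspace_bounded_measurable.
have := bD a f 0 bf b0; rewrite addr0.
exact: bounded_measurable_integrable.
Qed.

Lemma le_Rintegral_bounded f g : bm f -> bm g -> (forall x, f x <= g x) ->
  \int[m]_x f x <= \int[m]_x g x.
Proof.
move=> bf bg fg; apply: le_Rintegral => //;
  exact: bounded_measurable_integrable.
Qed.

Lemma Rintegral_cst1 r : \int[m]_x (cst r x) = r.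
Proof. by rewrite Rintegral_cst// total_mass mulr1. Qed.

Lemma Rintegral_indic1 A : measurable A -> \int[m]_x (\1_A x) = fine (m A).
Proof. by move=> mA; rewrite /Rintegral integral_indic// setIT. Qed.

Lemma convex_Rintegral_expR c :
  convex_on bm (fun g => c + \int[m]_x expR (g x)).
Proof.
move=> t f g bf bg t01; have [_ bD] := subspace_bounded_measurable.
have [b0 _] := subspace_bounded_measurable.
have bef := bounded_measurable_expR bf; have beg := bounded_measurable_expR bg.
have bS r h : bm h -> bm (r *: h).
  by move=> bh; rewrite -[_ *: _]addr0; exact: bD.
have E : \int[m]_x ((t *: (expR \o f) + (1 - t) *: (expR \o g)) x) =
    t * \int[m]_x expR (f x) + (1 - t) * \int[m]_x expR (g x).
  rewrite (Rintegral_linear t bef (bS (1 - t) _ beg)); congr (_ + _).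
  have := Rintegral_linear (1 - t) beg b0.
  by rewrite addr0 (Rintegral_cst1 0) addr0.
have : \int[m]_x expR ((t *: f + (1 - t) *: g) x) <=
   t * \int[m]_x expR (f x) + (1 - t) * \int[m]_x expR (g x).
  rewrite -E; apply: le_Rintegral_bounded.
  - by apply: bounded_measurable_expR; apply: bD => //; exact: bS.
  - by apply: bD => //; exact: bS.
  - move=> x.
    have [t0 t1] := andP t01.
    exact: (@convex_expR R (Itv01 t0 t1) (f x) (g x)).
by lra.
Qed.

End BoundedMeasurable.

Arguments bounded_measurable {d T R}.
Arguments subspace_bounded_measurable {d T R}.
Arguments bounded_measurable_cst {d T R} r.
Arguments bounded_measurable_indic {d T R} [A] _.
Arguments convex_Rintegral_expR {d T R} m c.

(** * Linear functionals dominated by an exponential integral *)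

Section DominatedFunctional.
Context d (T : measurableType d) (R : realType).
Variables (nu : probability T R) (L : (T -> R^o) -> R) (c : R).
Local Notation bm := (@bounded_measurable d T R).
Hypothesis Llin : linear_on bm L.
Hypothesis Lcst : L (cst 1) = 1.
Hypothesis Ldom : forall g, bm g -> L g <= c + \int[nu]_x expR (g x).

Let bm0 : bm 0 := subspace_bounded_measurable.1.
Let bmD a f g : bm f -> bm g -> bm (a *: f + g).
Proof. exact: subspace_bounded_measurable.2. Qed.
Let bmZ a f : bm f -> bm (a *: f).
Proof. by move=> bf; rewrite -[_ *: _]addr0; exact: bmD. Qed.

Let L0 : L 0 = 0.
Proof. by have := Llin (-1) bm0 bm0; rewrite scaler0 addr0; lra. Qed.

Let LZ a f : bm f -> L (a *: f) = a * L f.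
Proof. by move=> bf; have := Llin a bf bm0; rewrite addr0 L0 addr0. Qed.

(** Positivity: if h <= 0 then t L(h) <= c + 1 for every t >= 0, because
    e^(t h) <= 1; this is impossible if L(h) > 0. *)
Lemma dominated_functional_le f g : bm f -> bm g ->
  (forall x, f x <= g x) -> L f <= L g.
Proof.
move=> bf bg fg; have bh : bm (-1 *: g + f) by exact: bmD.
have : L (-1 *: g + f) <= 0; last by rewrite Llin//; lra.
rewrite leNgt; apply/negP => Lgt0.
pose t := (`|c| + 2) / L (-1 *: g + f).
have t0 : 0 <= t by rewrite divr_ge0 ?ltW// addr_ge0.
have := Ldom (bmZ t bh); rewrite LZ// /t divfK ?gt_eqF//.
have : \int[nu]_x expR ((t *: (-1 *: g + f)) x) <= 1.
  rewrite -[leRHS](Rintegral_cst1 nu); apply: le_Rintegral_bounded.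
  - exact/bounded_measurable_expR/bmZ.
  - exact: bounded_measurable_cst.
  - move=> x; rewrite [leRHS](esym (@expR0 R)) ler_expR.
    rewrite [leLHS](_ : _ = t * (-1 * g x + f x))//.
    by rewrite mulr_ge0_le0// mulN1r addrC subr_le0.
rewrite /t => H1 H2.
by have := ler_norm c; have := le_trans H2 (lerD (lexx c) H1); lra.
Qed.

(** Evaluate the domination at t 1_A, where e^(t 1_A) <= 1 + e^t 1_A. *)
Lemma dominated_functional_indic_le A t : measurable A -> 0 < t ->
  L \1_A <= (`|c| + 1 + expR t * fine (nu A)) / t.
Proof.
move=> mA t0; have bA : bm \1_A := bounded_measurable_indic mA.
rewrite ler_pdivlMr// mulrC -LZ//.
apply: le_trans (Ldom (bmZ t bA)) _; rewrite -addrA.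
apply: lerD (ler_norm c) _.
have b1 := @bounded_measurable_cst d T R 1.
have -> : 1 + expR t * fine (nu A) = \int[nu]_x ((expR t *: \1_A + cst 1) x).
  rewrite (Rintegral_linear _ _ bA b1) Rintegral_cst1 Rintegral_indic1//.
  by rewrite addrC.
apply: le_Rintegral_bounded.
- exact/bounded_measurable_expR/bmZ.
- exact: bmD.
move=> x.
rewrite [leLHS](_ : _ = expR (t * \1_A x))//.
rewrite [leRHS](_ : _ = expR t * \1_A x + 1)//.
rewrite indicE.
by case: (x \in A); rewrite /= ?mulr0 ?mulr1 ?expR0 ?add0r// lerDl.
Qed.

(** The continuity that yields countable additivity: for t = (|c| + 2) / e the
    previous bound is at most e as soon as nu(A n) <= e^(-t). *)
Lemma dominated_functional_cvg0 (A : nat -> set T) :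
  (forall n, measurable (A n)) -> fine (nu (A n)) @[n --> \oo] --> 0 ->
  L \1_(A n) @[n --> \oo] --> 0.
Proof.
move=> mA nuA; apply/cvgr0Pnorm_le => e e0.
pose t := (`|c| + 2) / e.
have t0 : 0 < t by rewrite divr_gt0// ltr_wpDl.
have : \forall n \near \oo, `|fine (nu (A n))| <= expR (- t).
  by move/cvgr0Pnorm_le : nuA; apply; exact: expR_gt0.
apply: filterS => n nuAn.
have L0n : 0 <= L \1_(A n).
  rewrite -L0; apply: dominated_functional_le => //.
  exact: bounded_measurable_indic.
rewrite ger0_norm//.
apply: le_trans (dominated_functional_indic_le (mA n) t0) _.
have et : e * t = `|c| + 2 by rewrite mulrC divfK// gt_eqF.
rewrite ler_pdivrMr// et.
have : expR t * fine (nu (A n)) <= 1; last by lra.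
rewrite -ler_pdivlMl ?expR_gt0// mulr1 -expRN.
exact: le_trans (ler_norm _) nuAn.
Qed.

(** The value of [L] on the indicator of a nonmeasurable set is arbitrary;
    truncation at 0 makes the set function nonnegative everywhere and changes
    nothing on measurable sets. *)
Definition functional_measure (A : set T) : \bar R := (Num.max 0 (L \1_A))%:E.
Local Notation gam := functional_measure.

Let gamE A : measurable A -> gam A = (L \1_A)%:E.
Proof.
move=> mA; rewrite /gam max_r// -L0; apply: dominated_functional_le => //.
exact: bounded_measurable_indic.
Qed.

Let gam0 : gam set0 = 0%E.
Proof. by rewrite gamE// indic0 L0. Qed.

Let gam_ge0 A : (0 <= gam A)%E.
Proof. by rewrite lee_fin le_max lexx. Qed.

Let LU (A B : set T) : measurable A -> measurable B -> A `&` B = set0 ->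
  L \1_(A `|` B) = L \1_A + L \1_B.
Proof.
move=> mA mB AB0.
have bA : bm \1_A := bounded_measurable_indic mA.
have bB : bm \1_B := bounded_measurable_indic mB.
rewrite -[L \1_A]mul1r -Llin//; congr L; apply/funext => x.
rewrite -[RHS]/(1 *: (\1_A x : R^o) + \1_B x) scale1r !indicE in_setU.
have [/set_mem Ax|_] := boolP (x \in A); last by rewrite add0r.
have [/set_mem Bx|_] := boolP (x \in B); last by rewrite addr0.
by have : (A `&` B) x by []; rewrite AB0.
Qed.

Let gam_sigma_additive : semi_sigma_additive gam.
Proof.
move=> F mF tF mUF.
(* the tails of the family: their nu-measures, hence their L-values, vanish *)
pose B n := \bigcup_(k in [set k | (n <= k)%N]) F k.
have mB n : measurable (B n) by apply: bigcup_measurable.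
have BS n : B n = F n `|` B n.+1.
  apply/seteqP; split=> [x [k /= nk Fx]|x [Fx|[k /= nk Fx]]].
  - by move: nk; rewrite leq_eqVlt => /predU1P[->|nk]; [left|right; exists k].
  - by exists n => /=.
  - by exists k => //=; exact: ltnW.
have FB n : F n `&` B n.+1 = set0.
  rewrite -subset0 => x [Fnx [k /= nk Fkx]].
  have : n = k by apply: tF => //; exists x.
  by move=> nkE; rewrite nkE ltnn in nk.
have B0 : B 0%N = \bigcup_n F n by apply: eq_bigcupl; split.
have LB n : L \1_(B 0%N) = \sum_(0 <= i < n) L \1_(F i) + L \1_(B n).
  elim: n => [|n IH]; first by rewrite big_nil add0r.
  by rewrite big_nat_recr//= IH {1}(BS n) LU// addrA.
have nuB : fine (nu (B n)) @[n --> \oo] --> 0.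
  have capB : \bigcap_n B n = set0.
    rewrite -subset0 => x Bx; have [k _ Fkx] := Bx 0%N I.
    have [j /= kj Fjx] := Bx k.+1 I.
    have : k = j by apply: tF => //; exists x.
    by move=> kE; rewrite kE ltnn in kj.
  have : (nu \o B) n @[n --> \oo] --> nu (\bigcap_n B n).
    apply: nonincreasing_cvg_mu => //.
    - by rewrite -ge0_fin_numE// fin_num_measure.
    - by rewrite capB.
    - move=> m n mn; apply/subsetPset => x [k /= nk Fx].
      by exists k => //=; exact: leq_trans nk.
  by rewrite capB measure0 => /fine_cvg.
rewrite (_ : (fun n => _) =
    (fun n => (\sum_(0 <= i < n) L \1_(F i))%:E)); last first.
  by apply/funext => n; rewrite -sumEFin; apply: eq_bigr => i _; rewrite gamE.
rewrite gamE//; apply: cvg_EFin; first by near=> n.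
have := dominated_functional_cvg0 mB nuB.
have -> : (fine \o (fun n => (\sum_(0 <= i < n) L \1_(F i))%:E)) =
    (fun n => L \1_(B 0%N) - L \1_(B n)).
  by apply/funext => n /=; rewrite (LB n) addrK.
move=> Bcvg; rewrite -B0 -[X in _ --> X]subr0.
by apply: cvgB => //; exact: cvg_cst.
Unshelve. all: by end_near. Qed.

HB.instance Definition _ := isMeasure.Build d T R gam
  gam0 gam_ge0 gam_sigma_additive.

Let gam_setT : gam setT = 1%E.
Proof. by rewrite gamE// indicT Lcst. Qed.

HB.instance Definition _ := Measure_isProbability.Build d T R gam gam_setT.

(** The difference [D] of the two functionals vanishes on indicators and is at
    most 2 sup|f|. If |f| <= K, adding K/2 - K 1_{f >= 0} to [f] brings its
    bound down to K/2 and does not change [D f]; iterating, [D f] = 0. *)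
Lemma dominated_functional_integral g : bm g -> L g = \int[gam]_x g x.
Proof.
pose D g := L g - \int[gam]_x g x.
have Dlin a f h : bm f -> bm h -> D (a *: f + h) = a * D f + D h.
  by move=> bf bh; rewrite /D Llin// (Rintegral_linear _ a bf bh); ring.
have Dindic A : measurable A -> D \1_A = 0.
  move=> mA; rewrite /D Rintegral_indic1// (_ : fine _ = L \1_A) ?subrr//.
  exact: (congr1 fine (gamE mA)).
have Dcst : D (cst 1) = 0 by rewrite -indicT Dindic.
have Dhalf n : forall (K : R) f, bm f -> (forall x, `|f x| <= K) ->
    `|D f| <= K *+ 2 / 2 ^+ n.
  elim: n => [K f bf fK|n IH K f bf fK].
    rewrite expr0 divr1 mulr2n (le_trans (ler_normB _ _))//.
    have b1 := @bounded_measurable_cst d T R 1.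
    have fK1 x : f x <= (K *: cst 1 : T -> R^o) x.
      by rewrite /= -[leRHS]/(K * 1) mulr1 (le_trans (ler_norm _)).
    have fK2 x : ((- K) *: cst 1 : T -> R^o) x <= f x.
      rewrite /= -[leLHS]/(- K * 1) mulr1 lerNl.
      by rewrite (le_trans (ler_norm _))// normrN.
    have bK r := bmZ r b1.
    have IK r : \int[gam]_x ((r *: cst 1 : T -> R^o) x) = r.
      have -> : (r *: cst 1 : T -> R^o) = cst r.
        by apply/funext => x; exact: mulr1.
      exact: (Rintegral_cst1 gam).
    apply: lerD; rewrite ler_norml; apply/andP; split.
    - have := dominated_functional_le (bK (- K)) bf fK2.
      by rewrite LZ// Lcst mulr1.
    - have := dominated_functional_le bf (bK K) fK1.
      by rewrite LZ// Lcst mulr1.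
    - by have := le_Rintegral_bounded gam (bK (- K)) bf fK2; rewrite IK.
    - by have := le_Rintegral_bounded gam bf (bK K) fK1; rewrite IK.
  pose P := [set x | 0 <= f x].
  have mP : measurable P.
    have := bf.1 measurableT _ (measurable_itv `[0, +oo[); rewrite setTI.
    by congr measurable; apply/seteqP; split=> x /=; rewrite in_itv/= andbT.
  have bP : bm \1_P := bounded_measurable_indic mP.
  have b1 := @bounded_measurable_cst d T R (K / 2).
  (* f shifted by -K/2 where it is nonnegative and by K/2 elsewhere *)
  pose h : T -> R^o := (- K) *: \1_P + (K / 2 *: cst 1 + f).
  have bh2 : bm (K / 2 *: cst 1 + f).
    by apply: bmD => //; exact: bounded_measurable_cst.
  have bh : bm h by apply: bmD.
  have -> : D f = D h.
    rewrite /h Dlin// Dindic// Dlin//; last exact: bounded_measurable_cst.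
    by rewrite Dcst !mulr0 !add0r.
  have -> : K *+ 2 / 2 ^+ n.+1 = (K / 2) *+ 2 / 2 ^+ n.
    by rewrite exprS invfM mulrA; congr (_ / _); lra.
  apply: IH => // x.
  have step (y : R) (b : bool) : b = (0 <= y) -> `|y| <= K ->
      `|- K * b%:R + (K / 2 * 1 + y)| <= K / 2.
    rewrite !ler_norml => -> /andP[yK1 yK2].
    by have [y0|y0] := leP 0 y; rewrite /=; lra.
  by apply: step (fK x); apply/idP/idP => [/set_mem//|f0]; exact: mem_set.
move=> bg; have [K gK] := bg.2; apply/eqP; rewrite -subr_eq0; apply/eqP.
rewrite -/(D g); apply/eqP; rewrite -normr_le0; apply/ler_addgt0Pr => e e0.
rewrite add0r.
have : K *+ 2 / 2 ^+ n @[n --> \oo] --> 0.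
  rewrite -[X in _ --> X](mulr0 (K *+ 2)); apply: cvgM; first exact: cvg_cst.
  rewrite (_ : (fun _ => _) = (fun n => 2^-1 ^+ n)); last first.
    by apply/funext => n; rewrite exprVn.
  by apply: cvg_expr; rewrite ger0_norm// invf_lt1// ltr1n.
move=> /cvgr0Pnorm_le/(_ _ e0)[n _ /(_ n (leqnn n))] /=.
exact/le_trans/(le_trans (Dhalf n K g bg gK))/ler_norm.
Qed.

Lemma dominated_functional_representation :
  exists gamma : probability T R, forall g, bm g -> L g = \int[gamma]_x g x.
Proof. by exists gam => g /dominated_functional_integral. Qed.

End DominatedFunctional.

(** * The Gibbs variational formula *)

(** The positive and negative parts are compared separately. When both have
    infinite integral the value is -oo, a convention under which the difference
    of extended reals stays monotone. *)
Lemma ae_le_integral d (T : measurableType d) (R : realType)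
    (m : {measure set T -> \bar R}) (f g : T -> \bar R) :
  measurable_fun [set: T] f -> measurable_fun [set: T] g ->
  {ae m, forall x, (f x <= g x)%E} ->
  (\int[m]_x f x <= \int[m]_x g x)%E.
Proof.
move=> mf mg fg; rewrite integralE [leRHS]integralE; apply: leeB.
- apply: ae_ge0_le_integral => //; [exact: measurable_funepos..|].
  apply: filterS fg => x fgx _; rewrite !funeposE.
  by rewrite ge_max !le_max fgx lexx/= orbT.
- apply: ae_ge0_le_integral => //; [exact: measurable_funeneg..|].
  apply: filterS fg => x fgx _; rewrite !funenegE.
  by rewrite ge_max !le_max leeN2 fgx lexx/= orbT.
Qed.

Section RelativeEntropy.
Context d (T : measurableType d) (R : realType).
Variables mu nu : probability T R.
Local Notation bm := (@bounded_measurable d T R).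
Local Open Scope charge_scope.

Local Notation density := ('d (charge_of_finite_measure mu) '/d nu).

(** The derivative of a measure seen as a charge can be negative on a null set,
    where its logarithm would be -oo. A nonnegative real version allows both the
    change of variables for nonnegative functions and real logarithms, since the
    set where it vanishes is mu-null. *)
Lemma real_density : mu `<< nu -> exists h : T -> R,
  [/\ measurable_fun [set: T] h, forall x, 0 <= h x,
      forall F : T -> \bar R, (forall x, (0 <= F x)%E) ->
        measurable_fun [set: T] F ->
        (\int[mu]_x F x = \int[nu]_x (F x * (h x)%:E))%E,
      {ae mu, forall x, 0 < h x} &
      (\int[mu]_x lne (density x) = \int[mu]_x (ln (h x))%:E)%E].
Proof.
move=> munu.
pose f := Radon_Nikodym_SigmaFinite.f mu nu.
have f_ge0 x : (0 <= f x)%E by exact: Radon_Nikodym_SigmaFinite.f_ge0.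
have f_fin x : f x \is a fin_num by exact: Radon_Nikodym_SigmaFinite.f_fin_num.
have fh x : f x = (fine (f x))%:E by rewrite fineK.
have mf : measurable_fun [set: T] f.
  exact: measurable_int (Radon_Nikodym_SigmaFinite.f_integrable munu).
have mh : measurable_fun [set: T] (fine \o f).
  by apply: measurableT_comp => //; exact: fine_measurable.
have hpos : {ae mu, forall x, 0 < fine (f x)}.
  pose N := [set x | fine (f x) <= 0].
  have mN : measurable N.
    have := mh measurableT _ (measurable_itv `]-oo, 0]); rewrite setTI.
    by congr measurable; apply/seteqP; split=> x /=; rewrite in_itv.
  exists N; split => //; last by move=> x /negP; rewrite -leNgt.
  rewrite (Radon_Nikodym_SigmaFinite.f_integral munu mN).
  apply: integral0_eq => x Nx; rewrite -/(f x) fh; congr EFin.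
  by apply/eqP; rewrite eq_le Nx fine_ge0.
have mdens : measurable_fun [set: T] density.
  by apply: (measurable_int nu); exact: Radon_Nikodym_integrable.
exists (fine \o f); split => //.
- by move=> x; exact: fine_ge0.
- move=> F F0 mF.
  rewrite -(Radon_Nikodym_SigmaFinite.change_of_variables munu F0)//.
  by apply: eq_integral => x _; rewrite -/(f x) /= -fh.
- apply: ae_eq_integral => //.
  + rewrite (_ : (fun x => _) = (fun x => if (density x <= 0)%E then -oo%E else
        (ln (fine (density x)))%:E)).
      apply: measurable_fun_ifT => //; first exact: measurable_fun_lee.
      by apply/measurable_EFinP; do 2 apply: measurableT_comp => //;
         exact: fine_measurable.
    apply/funext => x.
    have : density x \is a fin_num by exact: Radon_Nikodym_fin_num.
    by case: (density x).
  + by apply/measurable_EFinP; exact: measurableT_comp.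
  + have feq : ae_eq mu [set: T] f density.
      apply: (null_dominates_ae_eq measurableT munu).
      exact: ae_eq_Radon_Nikodym_SigmaFinite.
    apply: filterS2 feq hpos => x fx hx _.
    by rewrite -fx// fh/= lt_geF.
Qed.

Lemma Rintegral_expR_gt0 g : bm g -> 0 < \int[nu]_x expR (g x).
Proof.
move=> bg; have [K gK] := bg.2.
apply: (@lt_le_trans _ _ (expR (- K))); first exact: expR_gt0.
rewrite -[leLHS](Rintegral_cst1 nu); apply: le_Rintegral_bounded.
- exact: bounded_measurable_cst.
- exact: bounded_measurable_expR.
move=> x; rewrite ler_expR lerNl (le_trans (ler_norm _))// normrN.
exact: gK.
Qed.

(** Let k = g - log int e^g dnu - log h with h the density. Then e^k integrates
    to at most 1 against mu, so integrating 1 + k <= e^k gives the claim; the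
    inequality is used in the form 1 + k - e^k + log h <= log h, whose left-hand
    side is mu-integrable even if log h is not. *)
Lemma gibbs_variational_le g : bm g -> mu `<< nu ->
  ((\int[mu]_x g x - ln (\int[nu]_x expR (g x)))%:E <=
   \int[mu]_x lne (density x))%E.
Proof.
move=> bg /real_density[h [mh h0 hE hpos ->]].
set z := ln _.
pose k x := g x - z - ln (h x).
have mlnh : measurable_fun [set: T] (fun x => ln (h x)).
  exact: measurableT_comp.
have mk : measurable_fun [set: T] k.
  by apply: measurable_funB => //; apply: measurable_funB => //; exact: bg.1.
have be := bounded_measurable_expR bg.
have Z0 := Rintegral_expR_gt0 bg.
have intG : (\int[mu]_x (expR (k x))%:E <= 1)%E.
  rewrite hE//; last by apply/measurable_EFinP; exact: measurableT_comp.
  have -> : 1%E = (\int[nu]_x (expR (- z) * expR (g x))%:E)%E.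
    have -> : (\int[nu]_x (expR (- z) * expR (g x))%:E)%E =
        (\int[nu]_x (expR (- z) * expR (g x)))%:E.
      rewrite /Rintegral fineK//; apply: (@bounded_measurable_fin_num _ _ _ nu).
      by have := (@subspace_bounded_measurable d T R).2 (expR (- z)) _ _ be
        (@subspace_bounded_measurable d T R).1; rewrite addr0.
    rewrite RintegralZl//; last exact: bounded_measurable_integrable.
    by rewrite expRN lnK ?posrE// mulVf// gt_eqF.
  apply: ge0_le_integral => //.
  - by move=> x _; rewrite mule_ge0// lee_fin// expR_ge0.
  - apply: emeasurable_funM; apply/measurable_EFinP => //.
    exact: measurableT_comp.
  - apply/measurable_EFinP; apply: measurable_funM => //; exact: be.1.
  move=> x _; rewrite -EFinM lee_fin.
  have [hx|hx] := ltP 0 (h x); last first.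
    rewrite (_ : h x = 0) ?mulr0 ?mulr_ge0 ?expR_ge0//.
    by apply/eqP; rewrite eq_le hx h0.
  have -> : k x = - z + g x + - ln (h x) by rewrite /k; ring.
  by rewrite !expRD (expRN (ln _)) lnK ?posrE// divfK ?gt_eqF.
have iG : mu.-integrable [set: T] (EFin \o (expR \o k)).
  apply/integrableP; split.
    by apply/measurable_EFinP; exact: measurableT_comp.
  under eq_integral do rewrite gee0_abs ?lee_fin ?expR_ge0//.
  by rewrite (le_lt_trans intG)// ltry.
have bgz : bm (1 *: g + cst (1 - z)).
  apply: (@subspace_bounded_measurable d T R).2 => //.
  exact: bounded_measurable_cst.
have igz := bounded_measurable_integrable mu bgz.
apply: (@le_trans _ _
    (\int[mu]_x ((1 *: g + cst (1 - z)) x - expR (k x))%:E)%E); last first.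
  apply: ae_le_integral.
  - apply/measurable_EFinP; apply: measurable_funB; first exact: bgz.1.
    exact: measurableT_comp.
  - exact/measurable_EFinP.
  apply: aeW => x; rewrite lee_fin.
  rewrite [X in X - _](_ : _ = 1 * g x + (1 - z))//.
  by have := expR_ge1Dx (k x); rewrite /k; lra.
under eq_integral do rewrite EFinB.
rewrite integralB_EFin//.
have -> : (\int[mu]_x ((1 *: g + cst (1 - z)) x)%:E =
    (\int[mu]_x g x + (1 - z))%:E)%E.
  rewrite -[LHS]fineK; last exact: bounded_measurable_fin_num.
  congr EFin; have := @Rintegral_linear _ _ _ mu 1 g (cst (1 - z)) bg
    (bounded_measurable_cst (1 - z)).
  by rewrite (Rintegral_cst1 mu) mul1r.
have iG0 : (0 <= \int[mu]_x (expR (k x))%:E)%E.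
  by apply: integral_ge0 => x _; rewrite lee_fin expR_ge0.
have Gfin : (\int[mu]_x (expR (k x))%:E)%E \is a fin_num.
  by rewrite ge0_fin_numE// (le_lt_trans intG)// ltry.
move: intG; rewrite -(fineK Gfin) -EFinB !lee_fin => intG.
by lra.
Qed.

(** The functional int . dmu is itself dominated, so a nu-null set has
    mu-measure at most (|M - 1| + 1) / t for all t > 0. *)
Lemma variational_dominates M :
  (forall g, bm g -> \int[mu]_x g x <= M - 1 + \int[nu]_x expR (g x)) ->
  mu `<< nu.
Proof.
move=> Hdom; apply/null_content_dominatesP => A mA nuA0.
have mA0 := measure_ge0 mu A.
rewrite -[mu A]fineK ?fin_num_measure//; congr EFin.
apply/eqP; rewrite eq_le fine_ge0// andbT.
have H t : 0 < t -> fine (mu A) <= (`|M - 1| + 1) / t.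
  move=> t0; have := dominated_functional_indic_le
    (@Rintegral_linear _ _ _ mu) Hdom mA t0.
  by rewrite (_ : nu A = 0%E)// mulr0 addr0 Rintegral_indic1.
apply/ler_addgt0Pr => e e0; rewrite add0r.
have := H ((`|M - 1| + 1) / e); rewrite invfM invrK mulrA divff ?mul1r.
  by apply; rewrite divr_gt0// ltr_wpDl.
by rewrite gt_eqF// ltr_wpDl.
Qed.

(** The test functions are u n + v e, where u n is the positive part of log h
    cut at log (n + 1) and v e is minus the negative part cut at - log e.
    Since e^(u n + v e) <= e + h has nu-integral at most 1 + e, the hypothesis
    bounds int u n dmu by M + e plus the integral of the negative part of log h.
    Let e tend to 0, then n to infinity by monotone convergence. If the negative
    part has infinite integral, the entropy integral is -oo. *)
Lemma gibbs_variational_ge M :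
  (forall g, bm g -> \int[mu]_x g x <= M - 1 + \int[nu]_x expR (g x)) ->
  (\int[mu]_x lne (density x) <= M%:E)%E.
Proof.
move=> Hdom; have munu := variational_dominates Hdom.
have [h [mh h0 hE hpos ->]] := real_density munu.
pose psi x := (ln (h x))%:E.
have mpsi : measurable_fun [set: T] psi.
  by apply/measurable_EFinP; exact: measurableT_comp.
pose u n x := ln (Num.max 1 (Num.min (h x) n.+1%:R)).
pose v e x := ln (Num.min 1 (Num.max e (h x))).
have u_arg n x : 1 <= Num.max 1 (Num.min (h x) n.+1%:R) by rewrite le_max lexx.
have u_ge0 n x : 0 <= u n x by rewrite /u ln_ge0.
have bu n : bm (u n).
  split.
    apply: measurableT_comp => //; apply: measurable_maxr => //.
    exact: measurable_minr.
  exists (ln n.+1%:R) => x; rewrite ger0_norm// ler_ln ?posrE//.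
    by rewrite ge_max ge_min lexx orbT andbT ler1n.
  exact: lt_le_trans (u_arg _ _).
have v_arg e x : 0 < e -> 0 < Num.min 1 (Num.max e (h x)).
  by move=> e0; rewrite lt_min ltr01 lt_max e0.
have v_le0 e x : 0 < e -> v e x <= 0.
  by move=> e0; rewrite /v ln_le0// ge_min lexx.
have bv e : 0 < e -> e <= 1 -> bm (v e).
  move=> e0 e1; split.
    apply: measurableT_comp => //; apply: measurable_minr => //.
    exact: measurable_maxr.
  exists (- ln e) => x; rewrite ler0_norm ?v_le0// lerN2 ler_ln ?posrE ?v_arg//.
  by rewrite le_min e1 le_max lexx.
have euv n e x : 0 < e -> expR (v e x + u n x) <= e + h x.
  move=> e0; rewrite expRD !lnK ?posrE ?v_arg//; last first.
    exact: lt_le_trans (u_arg _ _).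
  have [h1|/ltW h1] := leP (h x) 1.
    rewrite [Num.max 1 _]max_l ?mulr1 ?ge_min ?h1//.
    by rewrite ge_max lerDl h0 lerDr (ltW e0) orbT.
  rewrite [Num.min 1 _]min_l ?mul1r ?le_max ?h1 ?orbT//.
  rewrite ge_max ge_min lerDr (ltW e0)/= andbT.
  by rewrite (le_trans h1)// lerDr ltW.
have inth : (\int[nu]_x (h x)%:E = 1)%E.
  have := hE (cst 1%E) (fun=> lee01) (measurable_cst _).
  rewrite integral_cst// mul1e total_mass.
  by move=> ->; apply: eq_integral => x _; rewrite mul1e.
have key n e : 0 < e -> e <= 1 ->
    ((\int[mu]_x u n x)%:E <= (M + e)%:E + \int[mu]_x psi^\- x)%E.
  move=> e0 e1.
  have /Hdom : bm (1 *: v e + u n).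
    by apply: (@subspace_bounded_measurable d T R).2 => //; exact: bv.
  rewrite (Rintegral_linear mu 1 (bv _ e0 e1) (bu n)) mul1r.
  have : \int[nu]_x expR ((1 *: v e + u n) x) <= e + 1.
    rewrite -lee_fin /Rintegral fineK; last first.
      apply: (@bounded_measurable_fin_num _ _ _ nu).
      apply: bounded_measurable_expR.
      by apply: (@subspace_bounded_measurable d T R).2 => //; exact: bv.
    have -> : ((e + 1)%:E = \int[nu]_x (e%:E + (h x)%:E))%E.
      rewrite ge0_integralD//; last 3 first.
      - by move=> x _; rewrite lee_fin ltW.
      - by move=> x _; rewrite lee_fin.
      - exact/measurable_EFinP.
      by rewrite inth integral_cst// total_mass mule1 EFinD.
    apply: ge0_le_integral => //.
    - apply/measurable_EFinP; apply: measurableT_comp => //.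
      apply: measurable_funD; last exact: (bu n).1.
      by apply: measurable_funM => //; exact: (bv _ e0 e1).1.
    - by apply: emeasurable_funD => //; exact/measurable_EFinP.
    - move=> x _; rewrite -EFinD lee_fin.
      rewrite [leLHS](_ : _ = expR (1 * v e x + u n x))// mul1r.
      exact: euv.
  move=> H1 H2.
  have H3 : \int[mu]_x u n x <= (M + e) + - \int[mu]_x v e x by lra.
  apply: (@le_trans _ _ ((M + e)%:E + (- \int[mu]_x v e x)%:E)%E).
    by rewrite -EFinD lee_fin.
  apply: leeD => //.
  have -> : ((- \int[mu]_x v e x)%:E = \int[mu]_x (- v e x)%:E)%E.
    rewrite EFinN /Rintegral fineK; last first.
      by apply: bounded_measurable_fin_num; exact: bv.
    rewrite -integralN/=; last first.
      apply: integrable_add_def => //.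
      exact: (bounded_measurable_integrable mu (bv _ e0 e1)).
    by apply: eq_integral => x _; rewrite EFinN.
  apply: ae_ge0_le_integral => //.
  - by move=> x _; rewrite lee_fin oppr_ge0 v_le0.
  - apply/measurable_EFinP; apply: measurableT_comp => //.
    exact: (bv _ e0 e1).1.
  - exact: measurable_funeneg.
  apply: filterS hpos => x hx _; rewrite funenegE /psi -EFinN -EFin_max lee_fin.
  rewrite le_max; have [h1|/ltW h1] := leP (h x) 1; apply/orP; [left|right].
    by rewrite lerN2 ler_ln ?posrE ?v_arg// le_min h1 le_max lexx orbT.
  by rewrite oppr_le0 /v min_l ?ln1// le_max h1 orbT.
have key0 n : ((\int[mu]_x u n x)%:E <= M%:E + \int[mu]_x psi^\- x)%E.
  have [[q qE]|qE] : (exists q, (\int[mu]_x psi^\- x = q%:E)%E) \/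
      (\int[mu]_x psi^\- x = +oo)%E.
  - have : (0 <= \int[mu]_x psi^\- x)%E by apply: integral_ge0.
    by case: (\int[mu]_x psi^\- x)%E => [q|//|//] _; [left; exists q|right].
  - rewrite qE -EFinD lee_fin; apply/ler_addgt0Pr => e e0.
    have e'0 : 0 < Num.min e 1 by rewrite lt_min e0 ltr01.
    have := key n _ e'0; rewrite ge_min lexx orbT => /(_ isT).
    rewrite qE -EFinD lee_fin => /le_trans; apply.
    by rewrite addrAC lerD2l ge_min lexx.
  - by rewrite qE addey// leey.
have ucvg : (\int[mu]_x psi^\+ x <= M%:E + \int[mu]_x psi^\- x)%E.
  have -> : (\int[mu]_x psi^\+ x = \int[mu]_x limn (fun n => (u n x)%:E))%E.
    apply: eq_integral => x _; apply/esym/cvg_lim => //.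
    apply: cvg_near_cst.
    exists (Num.trunc (h x)).+1 => // n /= hn.
    rewrite funeposE /psi -EFin_max; congr EFin; rewrite /u.
    rewrite (@min_l _ _ (h x)); last first.
      rewrite ltW// (lt_le_trans (truncnS_gt _))// ler_nat.
      exact: leqW hn.
    have [h1|/ltW h1] := leP (h x) 1.
      by rewrite ln1 max_r// ln_le0.
    by rewrite max_l// ln_ge0.
  have := @cvg_monotone_convergence _ _ _ mu _ measurableT
    (fun n x => (u n x)%:E).
  move=> /(_ _ _ _)/cvge_to_le; apply.
  - by move=> n; apply/measurable_EFinP; exact: (bu n).1.
  - by move=> n x _; rewrite lee_fin.
  - move=> x _ m n mn; rewrite lee_fin ler_ln ?posrE.
    + rewrite ge_max le_max lexx/= le_max; apply/orP; right.
      by rewrite le_min !ge_min lexx/= ler_nat ltnS mn orbT.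
    + exact: lt_le_trans (u_arg _ _).
    + exact: lt_le_trans (u_arg _ _).
  - apply: nearW => n; have := key0 n.
    by rewrite /Rintegral fineK//; exact: bounded_measurable_fin_num.
rewrite integralE.
have : (0 <= \int[mu]_x psi^\- x)%E by apply: integral_ge0.
case intn : (\int[mu]_x psi^\- x)%E => [q| |]// _; last by rewrite addeNy leNye.
by rewrite leeBlDr// -intn.
Qed.

End RelativeEntropy.

(** * Test functions from a separating subspace *)

Section SeparatingSubspace.
Context d (T : measurableType d) (R : realType).
Local Open Scope charge_scope.
Variables (mu nu : probability T R) (V : set (T -> R^o)).
Hypothesis Vbm : V `<=` bounded_measurable.
Hypothesis Vsub : linear_subspace V.
Hypothesis V1 : V (cst 1).
Hypothesis Vsep : forall gamma : probability T R,
  (forall g, V g -> \int[gamma]_x g x = \int[mu]_x g x) ->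
  forall A, measurable A -> gamma A = mu A.

(** Every dominated extension of int . dmu is integration against a probability
    measure, and separation leaves mu as the only candidate. *)
Lemma exponential_bound_extends c :
  (forall g, V g -> \int[mu]_x g x <= c + \int[nu]_x expR (g x)) ->
  forall g, bounded_measurable g ->
    \int[mu]_x g x <= c + \int[nu]_x expR (g x).
Proof.
move=> Vdom; have Vlin : linear_on V (fun g => \int[mu]_x g x).
  by move=> a f g /Vbm bf /Vbm bg; exact: Rintegral_linear.
have [L [Llin LV Ldom]] := hahn_banach subspace_bounded_measurable Vsub Vbm Vlin
  (convex_Rintegral_expR nu c) Vdom.
have L1 : L (cst 1) = 1 by rewrite LV ?Rintegral_cst1 //; exact: mem_set.
have [gamma Lgamma] := dominated_functional_representation Llin L1 Ldom.
have gammamu A : measurable A -> gamma A = mu A.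
  apply: Vsep => g Vg; rewrite -Lgamma; last exact: Vbm.
  by apply: LV; exact: mem_set.
move=> g bg; rewrite (le_trans _ (Ldom _ bg))// Lgamma// /Rintegral.
rewrite (@eq_measure_integral _ _ _ _ mu gamma)// => A mA _.
exact: gammamu.
Qed.

(** The inequality log z <= z - 1 turns the hypothesis into an exponential
    bound on [V], which extends to all bounded measurable functions. *)
Lemma separating_variational_ge M :
  (forall g, V g -> \int[mu]_x g x - ln (\int[nu]_x expR (g x)) <= M) ->
  mu `<< nu /\
  (\int[mu]_x lne (('d (charge_of_finite_measure mu) '/d nu) x) <= M%:E)%E.
Proof.
move=> HM.
have Hdom : forall g, bounded_measurable g ->
    \int[mu]_x g x <= M - 1 + \int[nu]_x expR (g x).
  apply: exponential_bound_extends => g Vg.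
  have Z0 := Rintegral_expR_gt0 nu (Vbm Vg).
  have lnZ : ln (\int[nu]_x expR (g x)) <= \int[nu]_x expR (g x) - 1.
    have := @le_ln1Dx R (\int[nu]_x expR (g x) - 1).
    by rewrite (addrC 1) subrK; apply; lra.
  by have := HM g Vg; lra.
by split; [exact: variational_dominates Hdom|exact: gibbs_variational_ge].
Qed.

End SeparatingSubspace.

Lemma cvge_pinfty_sup (R : realType) (f : R -> \bar R) (l : \bar R) :
  (forall b, (f b <= l)%E) ->
  (forall M : R, (M%:E < l)%E -> \forall b \near +oo, (M%:E < f b)%E) ->
  f b @[b --> +oo] --> l.
Proof.
move=> fl; case: l fl => [r| |] fl Hf.
- have Hfr e : 0 < e -> \forall b \near +oo, ((r - e)%:E < f b)%E.
    by move=> e0; apply: Hf; rewrite lte_fin ltrBlDr ltrDl.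
  have ffin b e : ((r - e)%:E < f b)%E -> f b \is a fin_num.
    by have := fl b; case: (f b).
  apply/fine_cvgP; split.
    by apply: filterS (Hfr 1 ltr01) => b; exact: ffin.
  apply/cvgrPdist_lt => e e0; apply: filterS (Hfr e e0) => b rb /=.
  have := fl b; move: (rb); rewrite -(fineK (ffin _ _ rb)) lte_fin lee_fin.
  move=> H1 H2.
  by rewrite ger0_norm ?subr_ge0// ltrBlDr addrC -ltrBlDr.
- by apply/cvgeyPgt => A; apply: Hf; rewrite ltry.
- rewrite (_ : f = cst -oo%E); first exact: cvg_cst.
  by apply/funext => b; apply/eqP; rewrite -leeNy_eq.
Qed.

Section Admissible.
Context {R : realType} {S : polishType R}.
Implicit Types (f g : S -> R) (G : set (S -> R)).

Lemma continuous_borel_measurable f :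
  continuous f -> measurable_fun [set: borel S] (f : borel S -> R).
Proof.
move=> /continuousP cf.
apply: (measurability _ (RGenOpens.measurableE R)) => _ [_ [a [b ->] <-]].
by rewrite setTI; apply: sub_sigma_algebra; exact/cf/interval_open.
Qed.

Lemma Cb_bounded_measurable f :
  Cb S f -> bounded_measurable (f : borel S -> R^o).
Proof.
move=> [cf bf]; split; first exact: continuous_borel_measurable.
have [K [_ fK]] := bf.
by exists (K + 1) => x; apply: fK => //; rewrite ltrDl.
Qed.

Lemma gibbs_functionalE (mu nu : probability (borel S) R) f :
  bounded_measurable (f : borel S -> R^o) ->
  (\int[mu]_x (f x)%:E - lne (\int[nu]_x (expR (f x))%:E))%E =
  (\int[mu]_x f x - ln (\int[nu]_x expR (f x)))%:E.
Proof.
move=> bf; have be := bounded_measurable_expR bf.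
rewrite -(fineK (bounded_measurable_fin_num mu bf)).
rewrite -(fineK (bounded_measurable_fin_num nu be)).
by rewrite lne_EFin //; exact: Rintegral_expR_gt0.
Qed.

Variable G : set (S -> R).
Hypothesis adm : admissible G.

Lemma admissible_conv f g t : G f -> G g -> 0 <= t <= 1 ->
  G (fun x => t * f x + (1 - t) * g x).
Proof.
move=> Gf Gg /andP[t0 t1].
have := admissible_convex adm (Itv01 t0 t1) (mem_set Gf) (mem_set Gg).
by move/set_mem.
Qed.

(** The union of the sets b G with b > 0, which is the linear span of an
    admissible set [G]. *)
Definition admissible_span : set (borel S -> R^o) :=
  [set g | exists b f, [/\ 0 < b, G f & g = (fun x => b * f x)]].

(** Closure under addition comes from convexity: b f + b' f' is (b + b') times
    a convex combination; the symmetry of [G] absorbs negative scalars. *)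
Lemma linear_subspace_admissible_span : linear_subspace admissible_span.
Proof.
split.
  exists 1, (cst 0); split=> //; first exact: (admissible_cst adm).
  by apply/funext => x; rewrite mulr0.
suff H : forall a x y, 0 <= a -> admissible_span x -> admissible_span y ->
    admissible_span (a *: x + y).
  move=> a x y Vx Vy; have [a0|/ltW a0] := leP 0 a; first exact: H.
  rewrite -[a]opprK scaleNr -scalerN; apply: H => //; first by rewrite oppr_ge0.
  have [b [f [b0 Gf ->]]] := Vx.
  exists b, (\- f); split => //; first exact: (admissible_opp adm).
  by apply/funext => z /=; rewrite mulrN.
move=> a _ _ a0 [b [f [b0 Gf ->]]] [b' [f' [b'0 Gf' ->]]].
have s0 : 0 < a * b + b' by rewrite ltr_wpDl// mulr_ge0// ltW.
exists (a * b + b'), (fun x => (a * b / (a * b + b')) * f x +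
  (1 - a * b / (a * b + b')) * f' x); split => //.
  apply: admissible_conv => //.
  rewrite divr_ge0 ?mulr_ge0 ?(ltW b0) ?(ltW s0)//=.
  by rewrite ler_pdivrMr// mul1r lerDl ltW.
apply/funext => x; rewrite [LHS](_ : _ = a * (b * f x) + b' * f' x)//.
by field; rewrite gt_eqF.
Qed.

Lemma admissible_span_bounded_measurable :
  admissible_span `<=` bounded_measurable.
Proof.
move=> _ [b [f [_ Gf ->]]].
have bf := Cb_bounded_measurable (admissible_sub adm Gf).
have [b0 bD] := @subspace_bounded_measurable _ (borel S) R.
by have := bD b _ _ bf b0; rewrite addr0.
Qed.

Lemma admissible_span_separates (gamma mu : probability (borel S) R) :
  (forall g, admissible_span g -> \int[gamma]_x g x = \int[mu]_x g x) ->
  forall A, measurable A -> gamma A = mu A.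
Proof.
move=> gm; apply: contrapT => neq.
have [g Gg] := admissible_determining adm neq; apply; apply: gm.
by exists 1, g; split => //; apply/funext => x; rewrite mul1r.
Qed.

Lemma Gdiv_le_relative_entropy b mu nu :
  (Gdiv (scale_set b G) mu nu <= relative_entropy mu nu)%E.
Proof.
apply: ge_ereal_sup => _ [_ [f Gf <-] <-].
have bf := Cb_bounded_measurable (admissible_sub adm Gf).
have [b0 bD] := @subspace_bounded_measurable _ (borel S) R.
have bbf := bD b _ _ bf b0; rewrite addr0 in bbf.
rewrite (gibbs_functionalE mu nu bbf) /relative_entropy.
case: asboolP => [munu|_]; last exact: leey.
exact: gibbs_variational_le.
Qed.

(** A single g = b0 f in the span witnesses the strict inequality, and for
    b > b0 it is b times (b0 / b) f, a point of the segment from 0 to f. *)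
Lemma relative_entropy_lt_Gdiv mu nu M :
  (M%:E < relative_entropy mu nu)%E ->
  \forall b \near +oo, (M%:E < Gdiv (scale_set b G) mu nu)%E.
Proof.
move=> MR.
have [g [Vg Mg]] : exists g, admissible_span g /\
    M < \int[mu]_x g x - ln (\int[nu]_x expR (g x)).
  apply: contrapT => nex.
  have V1 : admissible_span (cst 1).
    exists 1, (cst 1); split => //; first exact: (admissible_cst adm).
    by apply/funext => x; rewrite mulr1.
  have [|munu] := separating_variational_ge admissible_span_bounded_measurable
      linear_subspace_admissible_span V1 (@admissible_span_separates^~ mu)
      (nu := nu) (M := M).
    by move=> g Vg; rewrite leNgt; apply/negP => Mg; apply: nex; exists g.
  by apply/negP; rewrite -ltNge; move: MR; rewrite /relative_entropy asboolT.
have bg := admissible_span_bounded_measurable Vg.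
have [b0 [f [b00 Gf gE]]] := Vg.
exists b0; split; first exact: num_real.
move=> b bb0; apply: (@lt_le_trans _ _
    (\int[mu]_x g x - ln (\int[nu]_x expR (g x)))%:E); first by rewrite lte_fin.
rewrite -(gibbs_functionalE mu nu bg); apply: ereal_sup_ubound; exists g => //.
have b_gt0 := lt_trans b00 bb0.
exists (fun x => b0 / b * f x + (1 - b0 / b) * (cst 0 : S -> R) x).
  apply: admissible_conv => //; first exact: (admissible_cst adm).
  by rewrite divr_ge0 ?(ltW b00) ?(ltW b_gt0)//= ler_pdivrMr// mul1r ltW.
rewrite gE; apply/funext => x; rewrite mulr0 addr0 mulrA; congr (_ * _).
by rewrite mulrC divfK// gt_eqF.
Qed.

End Admissible.

Theorem proposition5p1 (R : realType) (S : polishType R)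
    (c : S -> S -> \bar R) (a : S -> R) (Gamma0 : set (S -> R))
    (c_ge0 : forall x y, (0 <= c x y)%E)
    (c_sym : forall x y, c x y = c y x)
    (condA : cost_dual c)
    (condB : measure_determining (cost_Lip c))
    (condC : cost_bounded c a)
    (condD : cost_local_modulus c)
    (Gamma0_adm : admissible Gamma0)
    (mu nu : probability (borel S) R)
    (mu_L1 : L1 a mu) (nu_L1 : L1 a nu) :
  Gdiv (scale_set b Gamma0) mu nu @[b --> +oo] --> relative_entropy mu nu.
Proof.
apply: cvge_pinfty_sup => [b|M].
  exact: Gdiv_le_relative_entropy.
exact: relative_entropy_lt_Gdiv.
Qed.
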